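(* Let $E_1$, $E_2$, $F$ and $Y$ be locally convex spaces, $U$, $V$ and $W$ be locally convex subsets with dense interior of $E_1$, $E_2$ and $F$ respectively, $r,s \in \mathbb{N}_0 \cup \{\infty\}$, $f\colon U \times V \rightarrow F$ a $C^{r,s}$-map with $f(U \times V ) \subseteq W$ and $g\colon W \rightarrow Y$ be a $C^{r+s}$-map. Then $$g \circ f\colon U \times V \rightarrow Y$$ is a $C^{r,s}$-map.
   Context: Locally convex spaces are real Hausdorff locally convex topological vector spaces. A subset $U$ of a locally convex space $E$ is called locally convex if every $x\in U$ has a convex neighbourhood in $U$. ''With dense interior'' means that the interior $U^\circ$ is dense in $U$. Convention: $r+s=\infty$ if $r=\infty$ or $s=\infty$. $C^r$-maps: For $f\colon U\to F$ with $U\subseteq E$ open, $D_hf(x):=\lim_{t\to0}t^{-1}(f(x+th)-f(x))$. The map $f$ is $C^r$ if for all $k\in\mathbb{N}_0$ with $k\le r$ the iterated directional derivatives $d^{(k)}f(x,y_1,\dots,y_k):=(D_{y_k}\cdots D_{y_1}f)(x)$ exist and define a continuous map $d^{(k)}f\colon U\times E^k\to F$. If $U$ is a locally convex subset with dense interior, $f\colon U\to F$ is $C^r$ if $f|_{U^\circ}$ is $C^r$ and each $d^{(k)}(f|_{U^\circ})$ extends to a (unique) continuous map $d^{(k)}f\colon U\times E^k\to F$ (with $d^{(0)}f=f$). $C^{r,s}$-maps: For $U\subseteq E_1$, $V\subseteq E_2$ open, $f\colon U\times V\to F$ is $C^{r,s}$ if for all $i,j\in\mathbb{N}_0$ with $i\le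 r$, $j\le s$ the iterated directional derivative $d^{(i,j)}f(x,y,w_1,\dots,w_i,v_1,\dots,v_j):=(D_{(w_i,0)}\cdots D_{(w_1,0)}D_{(0,v_j)}\cdots D_{(0,v_1)}f)(x,y)$ exists everywhere and $d^{(i,j)}f\colon U\times V\times E_1^i\times E_2^j\to F$ is continuous. If $U,V$ are locally convex subsets with dense interior, $f$ is $C^{r,s}$ if $f|_{U^\circ\times V^\circ}$ is $C^{r,s}$ and each $d^{(i,j)}(f|_{U^\circ\times V^\circ})$ extends to a continuous map $d^{(i,j)}f\colon U\times V\times E_1^i\times E_2^j\to F$ (with $d^{(0,0)}f=f$). *)

(* Defs.v *)
From HB Require Import structures.
From mathcomp Require Import all_boot all_order all_algebra.
From mathcomp Require Import all_classical all_reals all_analysis.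

Set Implicit Arguments.
Unset Strict Implicit.
Unset Printing Implicit Defensive.

Import Order.TTheory GRing.Theory Num.Theory.
Import numFieldNormedType.Exports.

Local Open Scope classical_set_scope.
Local Open Scope ring_scope.

Inductive order_of_diff := FinOrder of nat | InfOrder.

Definition le_order (k : nat) (r : order_of_diff) : Prop :=
  if r is FinOrder n then (k <= n)%N else True.

Definition add_order (r s : order_of_diff) : order_of_diff :=
  match r, s with
  | FinOrder m, FinOrder n => FinOrder (m + n)%N
  | _, _ => InfOrder
  end.

Section LocallyConvexSubsets.
Context {R : realType} {E : tvsType R}.

Definition locally_convex_subset (U : set E) : Prop :=
  forall x, U x ->
    exists C : set E, [/\ C `<=` U, convex_set C & within U (nbhs x) C].

Definition has_dense_interior (U : set E) : Prop := U `<=` closure U°.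

End LocallyConvexSubsets.

Section DirectionalDerivatives.
Context {R : realType} {E F : tvsType R}.

(** [derive] and [derivable] of MathComp-Analysis are restricted to normed
    modules; these are the same notions for topological vector spaces, with the
    value [0] when the limit does not exist. The limit is unique when F is
    Hausdorff. *)
Definition dir_quotient (f : E -> F) (x h : E) : R^o -> F :=
  fun t => t^-1 *: (f (x + t *: h) - f x).

Definition dir_derivable (f : E -> F) (x h : E) : Prop :=
  exists l : F, dir_quotient f x h t @[t --> (0 : R^o)^'] --> l.

Definition dir_derive (h : E) (f : E -> F) : E -> F :=
  fun x => xget 0 [set l : F | dir_quotient f x h t @[t --> (0 : R^o)^'] --> l].

(** [iter_derive [:: y1; ...; yk] f] is D_{yk} ... D_{y1} f: the head of the
    list is the direction of the innermost derivative. *)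
Fixpoint iter_derive (ys : seq E) (f : E -> F) : E -> F :=
  if ys is y :: ys' then iter_derive ys' (dir_derive y f) else f.

Fixpoint iter_derivable (O : set E) (ys : seq E) (f : E -> F) : Prop :=
  if ys is y :: ys' then
    (forall x, O x -> dir_derivable f x y) /\
    iter_derivable O ys' (dir_derive y f)
  else True.

End DirectionalDerivatives.

(** {ptws _ -> _} carries the product topology. *)
Notation power_space E k := {ptws 'I_k -> E}.

(** Maps defined on a subset are represented by functions on the whole space.
    [Cr r U] and [Crs r s U V] only depend on the values on the subset, since
    derivatives are only taken at its interior points. *)

Section Cr.
Context {R : realType} {E F : tvsType R}.

Definition dk (k : nat) (f : E -> F) : E * power_space E k -> F :=
  fun p => iter_derive [seq p.2 a | a <- enum 'I_k] f p.1.

Definition Cr_on_open (r : order_of_diff) (O : set E) (f : E -> F) : Prop :=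
  forall k, le_order k r ->
    (forall y : 'I_k -> E, iter_derivable O [seq y a | a <- enum 'I_k] f) /\
    {within O `*` [set: power_space E k], continuous (@dk k f)}.

Definition Cr (r : order_of_diff) (U : set E) (f : E -> F) : Prop :=
  Cr_on_open r U° f /\
  forall k, le_order k r ->
    exists df : E * power_space E k -> F,
      [/\ {within U `*` [set: power_space E k], continuous df},
          forall x y, U° x -> df (x, y) = dk f (x, y)
        & k = 0%N -> forall x y, U x -> df (x, y) = f x].

End Cr.

Section Crs.
Context {R : realType} {E1 E2 F : tvsType R}.

(** The directions of
    D_{(w_i,0)} ... D_{(w_1,0)} D_{(0,v_j)} ... D_{(0,v_1)}, innermost first. *)
Definition dij_directions (i j : nat) (w : 'I_i -> E1) (v : 'I_j -> E2) :
    seq (E1 * E2) :=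
  [seq (0, v b) | b <- enum 'I_j] ++ [seq (w a, 0) | a <- enum 'I_i].

Definition dij (i j : nat) (f : E1 * E2 -> F) :
    (E1 * E2) * power_space E1 i * power_space E2 j -> F :=
  fun p => iter_derive (dij_directions p.1.2 p.2) f p.1.1.

Definition Crs_on_open (r s : order_of_diff) (O1 : set E1) (O2 : set E2)
    (f : E1 * E2 -> F) : Prop :=
  forall i j, le_order i r -> le_order j s ->
    (forall (w : 'I_i -> E1) (v : 'I_j -> E2),
        iter_derivable (O1 `*` O2) (dij_directions w v) f) /\
    {within (O1 `*` O2) `*` [set: power_space E1 i] `*` [set: power_space E2 j],
      continuous (@dij i j f)}.

Definition Crs (r s : order_of_diff) (U : set E1) (V : set E2)
    (f : E1 * E2 -> F) : Prop :=
  Crs_on_open r s U° V° f /\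
  forall i j, le_order i r -> le_order j s ->
    exists df : (E1 * E2) * power_space E1 i * power_space E2 j -> F,
      [/\ {within (U `*` V) `*` [set: power_space E1 i]
                            `*` [set: power_space E2 j], continuous df},
          forall x y w v, U° x -> V° y ->
            df ((x, y), w, v) = dij f ((x, y), w, v)
        & i = 0%N -> j = 0%N -> forall x y w v, U x -> V y ->
            df ((x, y), w, v) = f (x, y)].

End Crs.

(* Main.v *)
Require Import Defs.
From mathcomp Require Import all_boot all_order all_algebra.
From mathcomp Require Import all_classical all_reals all_analysis.
From mathcomp Require Import ring lra.

Set Implicit Arguments.
Unset Strict Implicit.
Unset Printing Implicit Defensive.

Import Order.TTheory GRing.Theory Num.Theory.
Import numFieldNormedType.Exports.

Local Open Scope classical_set_scope.
Local Open Scope ring_scope.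

(** Differentiating [g \o f] along a list of directions produces a sum of terms
    [d^k g (f x; u_1 x, ..., u_k x)], where each [u_m] is an iterated derivative
    of [f] along a sublist of the directions (the Faa di Bruno formula). The
    combinatorics of this formula can be avoided: it is enough to have a class
    of functions that is stable under one differentiation of such a term. That
    class is [smooth_along ds]: the continuous functions on [U x V x parameters]
    that have continuously extendable derivatives along every sublist of [ds].
    [smooth_along_comp] proves by induction on [ds] that every term
    [d^k g (f; u_1, ..., u_k)] with [k + size ds <= r + s] belongs to it, because
    its derivative along the first direction is
    [d^(k+1) g (f; u_1, ..., u_k, f') + \sum_m d^k g (f; ..., u_m', ...)],
    a sum of terms of the same kind.

    The analytic content is this chain rule, [jet_chain]. An interior point of
    [U x V] may be sent by [f] to the boundary of [W], where the derivatives of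
    [g] are only limits of derivatives. [jet_strict] shows that difference
    quotients of [d^k g] between two points of [W] still converge to
    [d^(k+1) g]: near a point of [W] the two points lie in a convex subset of [W]
    with interior points, and pulling them slightly towards such an interior
    point moves the whole segment between them into the interior of [W], where
    the mean value theorem applies; then the pull tends to zero. The mean value
    theorem is used in the form [mean_value]: an open convex set that contains
    all velocities of a curve contains its chord, so that neither integrals nor
    linear functionals are involved. Strict differentiability together with
    the uniqueness of limits also gives the multilinearity of [d^k g] in its
    directions ([jet_linear]), which the chain rule needs.

    Finally, [Crs_smooth_along] and [smooth_along_iter_derive] translate between
    the differentiability class [Crs] and [smooth_along]. *)

(** * Limits, convexity and derivatives of curves in locally convex spaces *)

Section TvsLimits.
Context {R : realType} {E : tvsType R} {T : Type}.
Context (Fi : set_system T) {FF : Filter Fi}.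

Lemma tvs_cvgD (f g : T -> E) (a b : E) :
  f @ Fi --> a -> g @ Fi --> b -> f x + g x @[x --> Fi] --> a + b.
Proof.
move=> fa gb.
apply: (continuous2_cvg FF (h := +%R)) => //.
exact: (@add_continuous E (a, b)).
Qed.

Lemma tvs_cvgZ (k : T -> R^o) (f : T -> E) (l : R^o) (a : E) :
  k @ Fi --> l -> f @ Fi --> a -> k x *: f x @[x --> Fi] --> l *: a.
Proof.
move=> kl fa.
apply: (continuous2_cvg FF (h := fun (x : R^o) (y : E) => x *: y)) => //.
exact: (@scale_continuous R E (l, a)).
Qed.

Lemma tvs_cvgB (f g : T -> E) (a b : E) :
  f @ Fi --> a -> g @ Fi --> b -> f x - g x @[x --> Fi] --> a - b.
Proof.
move=> fa gb; apply: tvs_cvgD => //; rewrite -scaleN1r.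
under eq_fun do rewrite -scaleN1r.
by apply: tvs_cvgZ => //; exact: cvg_cst.
Qed.

Lemma tvs_cvg_sum (n : nat) (f : 'I_n -> T -> E) (a : 'I_n -> E) :
  (forall m, f m @ Fi --> a m) ->
  \sum_(m < n) f m x @[x --> Fi] --> \sum_(m < n) a m.
Proof.
elim: n f a => [|n IH] f a fa.
  under eq_fun do rewrite big_ord0.
  by rewrite big_ord0; exact: cvg_cst.
under eq_fun do rewrite big_ord_recl.
by rewrite big_ord_recl; apply: tvs_cvgD => //; apply: IH.
Qed.

End TvsLimits.

Section Convexity.
Context {R : realType} {E : tvsType R}.

Lemma convex_comb (A : set E) (a b : E) (t : R) :
  convex_set A -> A a -> A b -> 0 <= t <= 1 -> A (t *: a + (1 - t) *: b).
Proof.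
move=> cA Aa Ab t01.
have /(_ (mem_set Aa) (mem_set Ab)) := cA a b (Itv01 (andP t01).1 (andP t01).2).
by rewrite inE.
Qed.

Lemma nbhs_open_convex (x : E) (N : set E) : nbhs x N ->
  exists A, [/\ open A, convex_set A, A x & A `<=` N].
Proof.
move=> xN; have [B cB [oB /(_ x _ xN)[A [BA Ax] AN]]] := @locally_convex R E.
by exists A; split => //; [exact: oB|apply: cB; rewrite inE].
Qed.

(** Pulling a point of a convex set towards an interior point [c] makes it an
    interior point: the homothety of centre [a] that moves [c] to the new point
    carries a neighbourhood of [c] inside the set. *)
Lemma convex_interior_comb (C : set E) (a c : E) (e : R) :
  convex_set C -> C a -> C° c -> 0 < e <= 1 -> C° (e *: c + (1 - e) *: a).
Proof.
move=> cC Ca Cc /andP[e0 e1]; rewrite /interior.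
have en0 : e != 0 by rewrite gt_eqF.
pose psi (z : E) := e^-1 *: (z - (1 - e) *: a).
have psiC : psi @ nbhs (e *: c + (1 - e) *: a) --> c.
  rewrite [X in _ --> X](_ : c = psi (e *: c + (1 - e) *: a)); last first.
    by rewrite /psi addrK scalerA mulVf// scale1r.
  apply: (@tvs_cvgZ _ _ _ _ _ (fun=> e^-1)); first exact: cvg_cst.
  by apply: tvs_cvgB; [exact: cvg_id|exact: cvg_cst].
have : nbhs (e *: c + (1 - e) *: a) (psi @^-1` C) by exact: psiC.
apply: filterS => z /= Cz.
have -> : z = e *: psi z + (1 - e) *: a.
  by rewrite /psi scalerA mulfV// scale1r subrK.
by apply: convex_comb => //; rewrite ltW.
Qed.

End Convexity.

Lemma cvg_near_eq {T : Type} {U : topologicalType} (Fi : set_system T)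
    {FF : Filter Fi} (f g : T -> U) (l : U) :
  (\forall t \near Fi, f t = g t) -> f @ Fi --> l -> g @ Fi --> l.
Proof.
move=> fg; apply: cvg_trans; apply: near_eq_cvg.
by apply: filterS fg => t ->.
Qed.

Section CurveDerivative.
Context {R : realType} {F : tvsType R}.

(** The value [c0] at time [0] is given separately so that difference quotients
    along lines have exactly this form. *)
Definition has_deriv (c : R^o -> F) (c0 l : F) : Prop :=
  t^-1 *: (c t - c0) @[t --> (0 : R^o)^'] --> l.

Lemma has_deriv_unique (c : R^o -> F) c0 l l' : hausdorff_space F ->
  has_deriv c c0 l -> has_deriv c c0 l' -> l = l'.
Proof. by move=> hF; apply: cvg_unique. Qed.

Lemma has_deriv_near (c d : R^o -> F) c0 l :
  (\forall t \near (0 : R^o)^', c t = d t) ->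
  has_deriv c c0 l -> has_deriv d c0 l.
Proof.
by move=> cd; apply: cvg_near_eq; apply: filterS cd => t ->.
Qed.

Lemma has_deriv_cvg (c : R^o -> F) c0 l :
  has_deriv c c0 l -> c @ (0 : R^o)^' --> c0.
Proof.
move=> cl.
have: c0 + t *: (t^-1 *: (c t - c0)) @[t --> (0 : R^o)^'] --> c0 + 0 *: l.
  apply: tvs_cvgD; first exact: cvg_cst.
  by apply: tvs_cvgZ => //; exact: nbhs_dnbhs.
rewrite scale0r addr0; apply: cvg_trans; apply: near_eq_cvg.
near=> t; have t0 : t != 0 by near: t; exact: nbhs_dnbhs_neq.
by rewrite scalerA mulfV// scale1r addrC subrK.
Unshelve. all: by end_near. Qed.

Lemma has_derivD (c d : R^o -> F) c0 d0 l m :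
  has_deriv c c0 l -> has_deriv d d0 m ->
  has_deriv (fun t => c t + d t) (c0 + d0) (l + m).
Proof.
move=> cl dm; rewrite /has_deriv.
under eq_fun do rewrite opprD addrACA scalerDr.
exact: tvs_cvgD.
Qed.

Lemma has_derivZ (a : R) (c : R^o -> F) c0 l :
  has_deriv c c0 l -> has_deriv (fun t => a *: c t) (a *: c0) (a *: l).
Proof.
move=> cl; rewrite /has_deriv.
under eq_fun do rewrite -scalerBr scalerA mulrC -scalerA.
by apply: tvs_cvgZ => //; exact: cvg_cst.
Qed.

Lemma has_deriv_cst (c0 : F) : has_deriv (fun=> c0) c0 0.
Proof.
rewrite /has_deriv; under eq_fun do rewrite subrr scaler0.
exact: cvg_cst.
Qed.

Lemma dnbhs0_mul (a : R) : a != 0 ->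
  (fun t : R^o => (a * t : R^o)) @ (0 : R^o)^' --> (0 : R^o)^'.
Proof.
move=> a0 A A0.
have lim : a *: t @[t --> (0 : R^o)^'] --> (0 : R^o).
  rewrite -[X in _ --> X](scaler0 (R^o : lmodType R) a).
  apply: (@tvs_cvgZ R R^o _ _ _ (fun=> a)); first exact: cvg_cst.
  exact: nbhs_dnbhs.
have /= := lim _ A0; rewrite nbhs_simpl /= => At.
near=> t; apply: (near At t) => //.
by rewrite mulf_neq0//; near: t; exact: nbhs_dnbhs_neq.
Unshelve. all: by end_near. Qed.

(** A curve with parameter [a * t] runs [a] times as fast; the condition
    [c 0 = c0] is what the degenerate case [a = 0] needs. *)
Lemma has_deriv_scale (a : R) (c : R^o -> F) c0 l : c 0 = c0 ->
  has_deriv c c0 l -> has_deriv (fun t => c (a * t)) c0 (a *: l).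
Proof.
move=> <-; have [->|a0] := eqVneq a 0.
  by rewrite scale0r => _; under eq_fun do rewrite mul0r; exact: has_deriv_cst.
move=> /(cvg_comp _ _ (dnbhs0_mul a0)) cl.
have : a *: ((a * t)^-1 *: (c (a * t) - c 0)) @[t --> (0 : R^o)^'] --> a *: l.
  by apply: tvs_cvgZ => //; exact: cvg_cst.
apply: cvg_trans; apply: near_eq_cvg; near=> t.
by rewrite scalerA invfM mulrA mulfV// mul1r.
Unshelve. all: by end_near. Qed.

End CurveDerivative.

(** * The mean value theorem *)

Section MeanValue.
Context {R : realType} {F : tvsType R}.

(** Slopes over adjacent intervals average to the slope over their union, so
    the set of the [x] whose slope over [0, x] lies in [A] is closed under
    appending a short interval on which the slope lies in [A]. Its supremum
    belongs to it (append the interval that ends at the supremum) and cannot be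
    below [1] (append an interval that starts there). The first step uses the
    local hypothesis on the left of a point and the second one on its right. *)
Lemma convex_chord (A : set F) (c : R -> F) : convex_set A ->
  (forall x, 0 <= x <= 1 -> exists2 d : R, 0 < d &
    forall t, t != 0 -> `|t| < d -> A (t^-1 *: (c (x + t) - c x))) ->
  A (c 1 - c 0).
Proof.
move=> cA loc.
pose S := [set x : R | 0 <= x <= 1 /\ exists2 a, A a & c x - c 0 = x *: a].
(* the slope over [0, y] is the barycentre of the slopes over [0, x] and
   [x, y] with weights [x / y] and [1 - x / y] *)
have step x y : S x -> x < y -> y <= 1 -> A ((y - x)^-1 *: (c y - c x)) -> S y.
  move=> [/andP[x0 x1] [a Aa ca]] xy y1 Aq; have y0 : 0 < y by apply: le_lt_trans xy.
  have yn0 : y != 0 by rewrite gt_eqF.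
  have yxn0 : y - x != 0 by rewrite gt_eqF// subr_gt0.
  split; first by rewrite y1 ltW.
  exists ((1 - x / y) *: ((y - x)^-1 *: (c y - c x)) + (1 - (1 - x / y)) *: a).
    apply: convex_comb => //.
    have xy0 : 0 <= x / y by rewrite divr_ge0// ltW.
    have : x / y <= 1 by rewrite ler_pdivrMr// mul1r ltW.
    by move: xy0; lra.
  have -> : c y - c 0 = (c y - c x) + x *: a by rewrite -ca addrA subrK.
  rewrite scalerDr !scalerA; congr (_ + _ *: _); last by field.
  by rewrite [X in X *: _](_ : _ = 1) ?scale1r//; field; rewrite yn0 yxn0.
have S0 : S 0.
  split; first by rewrite lexx ler01.
  have [|d d0 /(_ (d / 2)) Ad] := loc 0; first by rewrite lexx ler01.
  exists ((d / 2)^-1 *: (c (0 + d / 2) - c 0)); last by rewrite subrr scale0r.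
  apply: Ad; first by rewrite gt_eqF// divr_gt0.
  by rewrite gtr0_norm ?divr_gt0//; lra.
have supS : has_sup S by split; [exists 0|exists 1 => x [/andP[]]].
have ubS x : S x -> x <= sup S by apply: ub_le_sup; case: supS.
have s0 : 0 <= sup S by exact: ubS.
have s1 : sup S <= 1 by apply: ge_sup => [|x [/andP[]]//]; exists 0.
have [|d d0 locs] := loc (sup S); first by rewrite s0.
have [x Sx xs] := sup_adherent d0 supS.
have Ss : S (sup S).
  have [<-//|xNs] := eqVneq x (sup S).
  have ltxs : x < sup S by rewrite lt_neqAle xNs ubS.
  apply: (step x) => //.
  have := locs (x - sup S); rewrite subrKC -opprB -[c x - _]opprB invrN.
  rewrite scaleNr scalerN opprK oppr_eq0 normrN; apply.
    by rewrite subr_eq0 eq_sym.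
  by rewrite gtr0_norm ?subr_gt0//; lra.
have [s_eq1|sN1] := eqVneq (sup S) 1.
  by case: Ss => _ [a Aa]; rewrite s_eq1 scale1r => ->.
have lts1 : sup S < 1 by rewrite lt_neqAle sN1.
pose t := Num.min (d / 2) (1 - sup S).
have t0 : 0 < t by rewrite lt_min divr_gt0//= subr_gt0.
have td : t < d by rewrite gt_min; apply/orP; left; lra.
have t1 : t <= 1 - sup S by rewrite ge_min lexx orbT.
have /ubS : S (sup S + t).
  apply: (step (sup S)) => //; [by lra|by lra|].
  rewrite [sup S + t - _]addrC addKr; apply: locs; first by rewrite gt_eqF.
  by rewrite gtr0_norm.
lra.
Qed.

(** Openness of [A] turns a velocity in [A] into short slopes in [A]. *)
Lemma mean_value (A : set F) (c : R^o -> F) : open A -> convex_set A ->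
  (forall x : R, 0 <= x <= 1 ->
    exists2 l, A l & has_deriv (fun t => c (x + t)) (c x) l) ->
  A (c 1 - c 0).
Proof.
move=> oA cA dc; apply: (@convex_chord A (c : R -> F)) => // x x01.
have [l Al dl] := dc x x01.
have nA : nbhs l A by move: oA Al; rewrite openE => /[apply].
have := dl _ nA; rewrite nbhs_simpl /= => /nbhs_ballP[d /= d0 dA].
exists d => // t t0 td; apply: dA => //=.
by rewrite -ball_normE /= sub0r normrN.
Qed.

End MeanValue.

(** * Derivatives of a map on a locally convex set with dense interior *)

Section ListLimits.
Context {R : realType} {F : tvsType R} {T : Type}.

(** The list of directions of a higher derivative varies with a parameter;
    the default value [0] makes the coordinates past the end converge
    trivially. *)
Definition seq_cvg (Fi : set_system T) (u : T -> seq F) (ls : seq F) : Prop :=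
  (forall t, size (u t) = size ls) /\
  forall m, (u t)`_m @[t --> Fi] --> ls`_m.

Context (Fi : set_system T) {FF : Filter Fi}.

Lemma seq_cvg_cst (ls : seq F) : seq_cvg Fi (fun=> ls) ls.
Proof. by split=> // m; exact: cvg_cst. Qed.

Lemma seq_cvg_cat (u v : T -> seq F) ls ms :
  seq_cvg Fi u ls -> seq_cvg Fi v ms ->
  seq_cvg Fi (fun t => u t ++ v t) (ls ++ ms).
Proof.
move=> [su uls] [sv vms]; split=> [t|m]; first by rewrite !size_cat su sv.
under eq_fun do rewrite nth_cat su.
by rewrite nth_cat; case: ifP => _; [exact: uls|exact: vms].
Qed.

Lemma seq_cvg_cons (v : T -> F) (u : T -> seq F) l ls :
  v @ Fi --> l -> seq_cvg Fi u ls ->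
  seq_cvg Fi (fun t => v t :: u t) (l :: ls).
Proof. by move=> vl [su uls]; split=> [t /=|[|m] //=]; rewrite ?su. Qed.

Lemma seq_cvg_rcons (u : T -> seq F) (v : T -> F) ls l :
  seq_cvg Fi u ls -> v @ Fi --> l ->
  seq_cvg Fi (fun t => rcons (u t) (v t)) (rcons ls l).
Proof.
move=> uls vl; under eq_fun do rewrite -cats1.
rewrite -cats1; apply: seq_cvg_cat => //; apply: seq_cvg_cons => //.
exact: seq_cvg_cst.
Qed.

Lemma seq_cvg_drop n (u : T -> seq F) ls :
  seq_cvg Fi u ls -> seq_cvg Fi (fun t => drop n (u t)) (drop n ls).
Proof.
move=> [su uls]; split=> [t|m]; first by rewrite !size_drop su.
by under eq_fun do rewrite nth_drop; rewrite nth_drop; exact: uls.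
Qed.

End ListLimits.

Lemma seq_cvg_fmap {R : realType} {F : tvsType R} {T T' : Type}
    (Fi : set_system T) (Fi' : set_system T') (h : T' -> T) (u : T -> seq F) ls :
  h @ Fi' --> Fi -> seq_cvg Fi u ls -> seq_cvg Fi' (u \o h) ls.
Proof.
move=> hFi [su uls]; split=> [t|m]; first exact: su.
exact: cvg_comp hFi (uls m).
Qed.

Lemma combE {R : realType} {E : lmodType R} (a b : E) (t : R) :
  t *: b + (1 - t) *: a = a + t *: (b - a).
Proof. by rewrite scalerBl scale1r scalerBr addrCA. Qed.

Lemma at_right0_cvg {R : realType} :
  (fun e : R => e : R^o) @ (0 : R)^'+ --> (0 : R^o).
Proof. by move=> A An; exact: (cvg_within (F := nbhs (0 : R))). Qed.

Lemma comb_cvg {R : realType} {E : tvsType R} (a b : E) :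
  e *: b + (1 - e) *: a @[e --> (0 : R)^'+] --> a.
Proof.
under eq_fun do rewrite combE.
suff: a + e *: (b - a) @[e --> (0 : R)^'+] --> a + 0 *: (b - a).
  by rewrite scale0r addr0.
apply: tvs_cvgD; first exact: cvg_cst.
by apply: (tvs_cvgZ at_right0_cvg); exact: cvg_cst.
Qed.

Lemma line_cvg {R : realType} {E : tvsType R} (z h : E) :
  z + t *: h @[t --> (0 : R^o)^'] --> z.
Proof.
suff: z + t *: h @[t --> (0 : R^o)^'] --> z + 0 *: h by rewrite scale0r addr0.
apply: tvs_cvgD; first exact: cvg_cst.
by apply: tvs_cvgZ; [exact: nbhs_dnbhs|exact: cvg_cst].
Qed.

Lemma near_line {R : realType} {E : tvsType R} (A : set E) (z h : E) :
  nbhs z A -> \forall t \near (0 : R^o)^', A (z + t *: h).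
Proof. by move=> zA; exact: (@line_cvg R E z h A zA). Qed.

Section Jets.
Context {R : realType} {F Y : tvsType R}.

(** [G z ys] stands for the continuous extension to [W] of the iterated
    derivative of [g] along [ys]. Continuity is stated for arbitrary filters so
    that it applies at once to curves, to product filters and to maps defined
    on a subset. Lists are used because [rcons] adds the direction of the
    outermost derivative. *)
Definition jet (N : order_of_diff) (W : set F) (g : F -> Y)
    (G : F -> seq F -> Y) : Prop :=
  [/\ forall z, W z -> G z [::] = g z,
      forall (T : Type) (Fi : set_system T) (c : T -> F) (u : T -> seq F) z ls,
        Filter Fi -> W z -> (\forall t \near Fi, W (c t)) -> c @ Fi --> z ->
        le_order (size ls) N -> seq_cvg Fi u ls ->
        G (c t) (u t) @[t --> Fi] --> G z ls
    & forall z ys y, W° z -> le_order (size ys).+1 N ->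
        has_deriv (fun t => G (z + t *: y) ys) (G z ys) (G z (rcons ys y))].

Lemma le_orderW k l N : (k <= l)%N -> le_order l N -> le_order k N.
Proof. by case: N => [n|//] kl; exact: leq_trans. Qed.

Context (N : order_of_diff) (W : set F) (g : F -> Y) (G : F -> seq F -> Y).
Hypothesis (hY : hausdorff_space Y).
Hypothesis (lcW : locally_convex_subset W) (diW : has_dense_interior W).
Hypothesis (J : jet N W g G).

(** [a] and [b] may lie on the boundary of [W]; for [e > 0] the points
    [e c + (1 - e) a] and [e c + (1 - e) b], and the segment between them, are
    interior, and the mean value theorem puts the difference quotient between
    them in [A]. Letting [e] tend to [0] costs only a closure. *)
Lemma jet_increment (A : set Y) (C : set F) (us : seq F) (a b c : F)
    (tau : R) (M : set F) :
  open A -> convex_set A -> convex_set C -> C `<=` W -> C a -> C b -> C° c ->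
  tau != 0 -> open M -> M (tau^-1 *: (b - a)) ->
  le_order (size us).+1 N ->
  (forall e x : R, 0 < e <= 1 -> 0 <= x <= 1 -> forall h, M h ->
    A (G (e *: c + (1 - e) *: (x *: b + (1 - x) *: a)) (rcons us h))) ->
  closure A (tau^-1 *: (G b us - G a us)).
Proof.
move=> oA cA cC CW Ca Cb Cc tau0 oM Mh sus AG.
have [_ Jc Jd] := J.
pose h := tau^-1 *: (b - a).
pose pt (e x : R) := e *: c + (1 - e) *: (x *: b + (1 - x) *: a).
have ptW (e x : R) : 0 < e <= 1 -> 0 <= x <= 1 -> W° (pt e x).
  move=> e01 x01; apply: (interiorS CW).
  by apply: convex_interior_comb => //; exact: convex_comb.
have inA (e : R) : 0 < e <= 1 -> M ((1 - e) *: h) ->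
    A (tau^-1 *: (G (pt e 1) us - G (pt e 0) us)).
  move=> e01 Meh; rewrite scalerBr.
  apply: (@mean_value _ _ A (fun x => tau^-1 *: G (pt e x) us)) => // x x01.
  exists (G (pt e x) (rcons us ((1 - e) *: h))); first exact: AG.
  (* [pt e (x + s)] is [pt e x + (tau * s) *: y]; the factors [tau] and
     [tau^-1] then cancel *)
  set y := (1 - e) *: h; pose line (t : R^o) := G (pt e x + t *: y) us.
  have line0 : line 0 = G (pt e x) us by rewrite /line scale0r addr0.
  have Jline := Jd (pt e x) us y (ptW e x e01 x01) sus.
  have := has_derivZ (a := tau^-1) (@has_deriv_scale _ _ tau line _ _ line0 Jline).
  rewrite scalerA mulVf// scale1r.
  apply: has_deriv_near; apply: nearW => s /=; congr (_ *: G _ _).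
  rewrite /line /pt /y /h !scalerA -addrA; congr (_ + _).
  rewrite (_ : tau * s * (1 - e) / tau = (1 - e) * s); last by field.
  rewrite -scalerA -scalerDr !combE; congr (_ *: _).
  by rewrite [(x + s) *: _]scalerDl addrA.
have e01 : \forall e \near (0 : R)^'+, 0 < e <= 1.
  by near=> e; apply/andP; split; near: e;
    [exact: nbhs_right_gt|exact: nbhs_right_le].
have Gcvg (x : R) : 0 <= x <= 1 ->
    G (pt e x) us @[e --> (0 : R)^'+] --> G (x *: b + (1 - x) *: a) us.
  move=> x01; apply: (Jc _ _ (pt^~ x) (fun=> us)).
  - by apply: CW; exact: convex_comb.
  - by apply: filterS e01 => e e01; apply: interior_subset; exact: ptW.
  - exact: comb_cvg.
  - exact: le_orderW sus.
  - exact: seq_cvg_cst.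
have lim : tau^-1 *: (G (pt e 1) us - G (pt e 0) us) @[e --> (0 : R)^'+] -->
    tau^-1 *: (G b us - G a us).
  apply: (@tvs_cvgZ _ _ _ _ _ (fun=> tau^-1)); first exact: cvg_cst.
  have -> : b = 1 *: b + (1 - 1) *: a by rewrite subrr scale0r scale1r addr0.
  have {2}-> : a = 0 *: b + (1 - 0) *: a.
    by rewrite subr0 scale0r scale1r add0r.
  by apply: tvs_cvgB; apply: Gcvg; rewrite ?lexx ?ler01.
have Mcvg : (1 - e) *: h @[e --> (0 : R)^'+] --> h.
  suff: (1 - e) *: h @[e --> (0 : R)^'+] --> (1 - 0) *: h.
    by rewrite subr0 scale1r.
  apply: (@tvs_cvgZ _ _ _ _ _ (fun e : R => 1 - e : R^o)); last exact: cvg_cst.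
  by apply: (@tvs_cvgB R R^o); [exact: cvg_cst|exact: at_right0_cvg].
have nM : nbhs h M by apply: open_nbhs_nbhs.
move=> B /lim /= nB.
have [e [Be [e01' Meh]]] := @filter_ex _ (0 : R)^'+ _ _
  (filterI (nB : \forall e \near (0 : R)^'+, B _) (filterI e01 (Mcvg _ nM))).
by exists (tau^-1 *: (G (pt e 1) us - G (pt e 0) us)); split=> //; exact: inA.
Unshelve. all: by end_near. Qed.

(** A locally convex space is regular and has a basis of open convex sets, so
    it is enough to bound the quotient by an open convex set [A] whose closure
    lies in a given neighbourhood [K] of the limit. Continuity of [G] on
    [W], applied to the product of [Fi] and the filters of [z] and [y], provides
    neighbourhoods [N1] of the base point and [M] of the direction on which the
    next derivative stays in [A], and [jet_increment] concludes. *)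
Lemma jet_strict (T : Type) (Fi : set_system T) (tau : T -> R)
    (a b : T -> F) (u : T -> seq F) (z y : F) (ls : seq F) :
  Filter Fi -> W z -> (\forall t \near Fi, tau t != 0) ->
  (\forall t \near Fi, W (a t)) -> (\forall t \near Fi, W (b t)) ->
  a @ Fi --> z -> b @ Fi --> z ->
  (tau t)^-1 *: (b t - a t) @[t --> Fi] --> y ->
  le_order (size ls).+1 N -> seq_cvg Fi u ls ->
  (tau t)^-1 *: (G (b t) (u t) - G (a t) (u t)) @[t --> Fi] -->
    G z (rcons ls y).
Proof.
move=> FF Wz tau0 Wa Wb az bz yl sls uls K nK; have [_ Jc _] := J.
have [B nB clB] := @uniform_regular Y _ _ nK.
have [A [oA cA Av AB]] := nbhs_open_convex nB.
pose Fp := filter_prod (filter_prod Fi (within W (nbhs z))) (nbhs y).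
have p11 : (fun p => p.1.1) @ Fp --> Fi by exact: cvg_comp cvg_fst cvg_fst.
have p12 : (fun p => p.1.2) @ Fp --> within W (nbhs z).
  exact: cvg_comp cvg_fst cvg_snd.
have lim : G p.1.2 (rcons (u p.1.1) p.2) @[p --> Fp] --> G z (rcons ls y).
  apply: (Jc _ Fp (fun p => p.1.2) (fun p => rcons (u p.1.1) p.2)) => //.
  - exact: (p12 W (@withinT _ (nbhs z) W _)).
  - exact: (cvg_trans p12 (@cvg_within _ (nbhs z) _ W)).
  - by rewrite size_rcons.
  - apply: seq_cvg_rcons; last exact: cvg_snd.
    exact: seq_cvg_fmap p11 uls.
have nA : nbhs (G z (rcons ls y)) A by apply: open_nbhs_nbhs.
have [[P2 M0] [/= [[P N0] /= [FP zN0] PN0] yM0] PA] := lim _ nA.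
have [M [oM _ My MM0]] := nbhs_open_convex yM0.
have [C [CW cC zC]] := lcW Wz.
(* [N1] is shrunk so that its trace on [W] lies in the convex set [C] *)
have [N1 [oN1 cN1 N1z N1N]] := nbhs_open_convex (filterI zN0 zC).
have [c [Wc N1c]] := diW Wz (open_nbhs_nbhs (conj oN1 N1z)).
have nM : nbhs y M by apply: open_nbhs_nbhs.
have nN1 : nbhs z N1 by apply: open_nbhs_nbhs.
have subC x : N1 x -> W x -> C x by move=> /N1N/[apply]; case.
have Cc : C° c.
  apply: filterS2 (open_nbhs_nbhs (conj oN1 N1c)) Wc => x N1x; exact: subC.
change (\forall t \near Fi, K ((tau t)^-1 *: (G (b t) (u t) - G (a t) (u t)))).
near=> t.
apply: clB; apply: (closureS AB).
have Wat : W (a t) by near: t.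
have Wbt : W (b t) by near: t.
have N1a : N1 (a t) by near: t; exact: az.
have N1b : N1 (b t) by near: t; exact: bz.
apply: (@jet_increment A C (u t) (a t) (b t) c (tau t) M) => //.
- exact: subC.
- exact: subC.
- by near: t.
- by near: t; exact: yl.
- by rewrite (proj1 uls).
- move=> e x e01 x01 h Mh.
  set w := e *: c + _.
  have N1w : N1 w.
    apply: convex_comb => //; last by case/andP: e01 => /ltW -> ->.
    exact: convex_comb.
  have Cw : C w.
    apply: interior_subset; apply: convex_interior_comb => //.
      by apply: convex_comb => //; exact: subC.
  apply: (PA (t, w, h)); split=> /=; last exact: MM0.
  apply: PN0; split=> /=; first by near: t.
  by have [] := N1N _ N1w (CW _ Cw).
Unshelve. all: by end_near. Qed.

(** The increment along [t (a y1 + y2)] is the increment along [t a y1]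
    followed by an increment along [t y2] from a moving base point; strict
    differentiability handles the latter. *)
Lemma jet_linear_last (z y1 y2 : F) (pre : seq F) (a : R) :
  W° z -> le_order (size pre).+1 N ->
  G z (rcons pre (a *: y1 + y2)) =
    a *: G z (rcons pre y1) + G z (rcons pre y2).
Proof.
move=> Wz spre; have [_ _ Jd] := J.
apply: (has_deriv_unique hY (Jd z pre (a *: y1 + y2) Wz spre)).
pose phi (t : R^o) := G (z + t *: y1) pre.
have phi0 : phi 0 = G z pre by rewrite /phi scale0r addr0.
have d1 := @has_deriv_scale _ _ a phi _ _ phi0 (Jd z pre y1 Wz spre).
have Wnear h : \forall t \near (0 : R^o)^', W (z + t *: h).
  exact: near_line.
have d2 : t^-1 *: (G (z + t *: (a *: y1 + y2)) pre - G (z + t *: (a *: y1)) pre)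
    @[t --> (0 : R^o)^'] --> G z (rcons pre y2).
  apply: (@jet_strict _ _ (fun t : R^o => t) _ _ (fun=> pre)) => //.
  - exact: interior_subset.
  - exact: nbhs_dnbhs_neq.
  - exact: line_cvg.
  - exact: line_cvg.
  - apply: cvg_near_cst; near=> t.
    have t0 : t != 0 by near: t; exact: nbhs_dnbhs_neq.
    rewrite opprD addrACA subrr add0r -scalerBr addrAC subrr add0r.
    by rewrite scalerA mulVf// scale1r.
  - exact: seq_cvg_cst.
apply: cvg_near_eq (tvs_cvgD d1 d2); near=> t.
rewrite -scalerDr; congr (_ *: _); rewrite /phi scalerA [t * a]mulrC.
by rewrite addrC addrA subrK.
Unshelve. all: by end_near. Qed.

(** Linearity in an earlier direction is inherited from
    [jet_linear_last] by differentiating along the later ones. *)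
Lemma jet_linear_interior (z y1 y2 : F) (pre post : seq F) (a : R) :
  W° z -> le_order (size pre + (size post).+1) N ->
  G z (pre ++ (a *: y1 + y2) :: post) =
    a *: G z (pre ++ y1 :: post) + G z (pre ++ y2 :: post).
Proof.
elim/last_ind: post z => [|post y IH] z Wz.
  by rewrite addn1 !cats1 => spre; exact: jet_linear_last.
rewrite size_rcons addnS => sN; have [_ _ Jd] := J.
have sN' : le_order (size pre + (size post).+1) N by exact: le_orderW sN.
have d x : has_deriv (fun t => G (z + t *: y) (pre ++ x :: post))
    (G z (pre ++ x :: post)) (G z (pre ++ x :: rcons post y)).
  have := Jd z (pre ++ x :: post) y Wz.
  by rewrite size_cat /= => /(_ sN); rewrite rcons_cat.
apply: (has_deriv_unique hY (d _)).
have := has_derivD (has_derivZ (a := a) (d y1)) (d y2).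
rewrite -IH//; apply: has_deriv_near.
have : \forall t \near (0 : R^o)^', W° (z + t *: y).
  by apply: near_line; exact: nbhs_interior.
by apply: filterS => t Wt; rewrite IH.
Qed.

(** Both sides are continuous on [W] and agree on its dense interior. *)
Lemma jet_linear (z y1 y2 : F) (pre post : seq F) (a : R) :
  W z -> le_order (size pre + (size post).+1) N ->
  G z (pre ++ (a *: y1 + y2) :: post) =
    a *: G z (pre ++ y1 :: post) + G z (pre ++ y2 :: post).
Proof.
move=> Wz sN; have [_ Jc _] := J.
have pF : ProperFilter (within W° (nbhs z)) := within_nbhs_proper (diW Wz).
have lim x : G w (pre ++ x :: post) @[w --> within W° (nbhs z)] -->
    G z (pre ++ x :: post).
  apply: (Jc _ _ id (fun=> pre ++ x :: post)) => //.
  - by apply: filterS (withinT _ _) => w; exact: interior_subset.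
  - exact: cvg_within.
  - by rewrite size_cat.
  - exact: seq_cvg_cst.
apply: (cvg_unique hY (lim _)).
have lima : (fun=> a : R^o) @ within W° (nbhs z) --> (a : R^o) by exact: cvg_cst.
apply: cvg_near_eq (tvs_cvgD (tvs_cvgZ lima (lim y1)) (lim y2)).
by apply: filterS (withinT _ _) => w Ww; rewrite jet_linear_interior.
Qed.

Lemma jet_linearB (z x y : F) (pre post : seq F) (a : R) :
  W z -> le_order (size pre + (size post).+1) N ->
  G z (pre ++ (a *: (x - y)) :: post) =
    a *: (G z (pre ++ x :: post) - G z (pre ++ y :: post)).
Proof.
move=> Wz sN; pose L v := G z (pre ++ v :: post).
have L_lin b v w : L (b *: v + w) = b *: L v + L w by exact: jet_linear.
have L0 : L 0 = 0.
  apply: (@addrI _ (L 0)); rewrite addr0 -{1}[L 0]scale1r -L_lin.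
  by rewrite scaler0 addr0.
change (L (a *: (x - y)) = a *: (L x - L y)).
rewrite -[a *: (x - y)]addr0 L_lin L0 addr0; congr (_ *: _).
apply: (@addIr _ (L y)); rewrite subrK -[L (x - y)]scale1r -L_lin.
by rewrite scale1r subrK.
Qed.

(** The increment of [G (c t) (u t)] splits into
    [G (c t) (u t) - G z (u t)], handled by [jet_strict], and
    [G z (u t) - G z us], which telescopes by replacing the entries of [u t] by
    those of [us] one at a time, from the left; by linearity each replacement
    contributes [G z] with a difference quotient as its [m]-th entry. *)
Lemma jet_chain (c : R^o -> F) (u : R^o -> seq F) (z c' : F) (us us' : seq F) :
  W z -> (\forall t \near (0 : R^o)^', W (c t)) -> has_deriv c z c' ->
  le_order (size us).+1 N -> (forall t, size (u t) = size us) ->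
  (forall m, (m < size us)%N -> has_deriv (fun t => (u t)`_m) us`_m us'`_m) ->
  has_deriv (fun t => G (c t) (u t)) (G z us)
    (G z (rcons us c') +
     \sum_(m < size us) G z (take m us ++ us'`_m :: drop m.+1 us)).
Proof.
move=> Wz Wc dc sN su du; have [_ Jc _] := J.
have uus : seq_cvg (0 : R^o)^' u us.
  split=> // m; have [lem|gem] := ltnP m (size us).
    exact: has_deriv_cvg (du m lem).
  under eq_fun do rewrite nth_default ?su//.
  by rewrite nth_default//; exact: cvg_cst.
have d1 : t^-1 *: (G (c t) (u t) - G z (u t)) @[t --> (0 : R^o)^'] -->
    G z (rcons us c').
  apply: (@jet_strict _ _ (fun t : R^o => t) (fun=> z) c) => //.
  - exact: nbhs_dnbhs_neq.
  - exact: nearW.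
  - exact: cvg_cst.
  - exact: has_deriv_cvg dc.
have sm (m : 'I_(size us)) : (size (take m us) + (size (drop m.+1 us)).+1)%N = size us.
  by rewrite size_takel 1?ltnW// size_drop subnSK// subnKC// ltnW.
have d2 : \sum_(m < size us)
      G z (take m us ++ (t^-1 *: ((u t)`_m - us`_m)) :: drop m.+1 (u t))
    @[t --> (0 : R^o)^'] -->
    \sum_(m < size us) G z (take m us ++ us'`_m :: drop m.+1 us).
  apply: tvs_cvg_sum => m; apply: (Jc _ _ (fun=> z) (fun t => take m us ++
    (t^-1 *: ((u t)`_m - us`_m)) :: drop m.+1 (u t))) => //.
  - exact: nearW.
  - exact: cvg_cst.
  - by rewrite size_cat /= sm; exact: le_orderW sN.
  - apply: seq_cvg_cat; first exact: seq_cvg_cst.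
    by apply: seq_cvg_cons; [exact: du|exact: seq_cvg_drop].
apply: cvg_near_eq (tvs_cvgD d1 d2); near=> t.
have t0 : t != 0 by near: t; exact: nbhs_dnbhs_neq.
pose h m := G z (take m us ++ drop m (u t)).
transitivity (t^-1 *: (G (c t) (u t) - G z (u t)) +
    \sum_(m < size us) t^-1 *: (h m - h m.+1)); last first.
  rewrite -scaler_sumr -scalerDr; congr (_ *: _).
  have -> : \sum_(m < size us) (h m - h m.+1) = h 0%N - h (size us).
    rewrite -(big_mkord xpredT (fun m => h m - h m.+1)).
    rewrite -[RHS]opprB -telescope_sumr// -sumrN.
    by apply: eq_bigr => m _; rewrite opprB.
  rewrite /h take0 drop0 take_size -[in drop (size us) _](su t) drop_size cats0.
  by rewrite addrA subrK.
congr (_ + _); apply: eq_bigr => m _.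
rewrite jet_linearB//; last first.
  by rewrite size_drop su -(size_drop m.+1) sm; exact: le_orderW sN.
congr (_ *: (_ - _)); rewrite /h.
  by rewrite -(drop_nth 0)// su.
by rewrite (take_nth 0)// cat_rcons.
Unshelve. all: by end_near. Qed.

End Jets.

(** * Functions with continuous derivatives along a list of directions *)

Section SmoothAlong.
Context {R : realType} {P : topologicalType} {I : Type}.
Context (line : I -> P -> R^o -> P) (D D0 : set P).

(** Both [smooth_along ds' u] and [smooth_along ds' u'] are required, so that
    derivatives along all sublists of [ds] are covered and not only those along
    its prefixes: the product rule distributes the directions over the factors
    of a term. [line d p] is the curve through [p] in direction [d]. The
    derivatives are taken at the points of [D0], the continuity is on the
    larger set [D]. *)
Fixpoint smooth_along {F : tvsType R} (ds : seq I) (u : P -> F) : Prop :=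
  {within D, continuous u} /\
  if ds is d :: ds' then
    smooth_along ds' u /\
    exists u' : P -> F,
      (forall p, D0 p -> has_deriv (fun t => u (line d p t)) (u p) (u' p)) /\
      smooth_along ds' u'
  else True.

Lemma smooth_along_continuous {F : tvsType R} ds (u : P -> F) :
  smooth_along ds u -> {within D, continuous u}.
Proof. by case: ds => [|d ds] []. Qed.

Lemma smooth_along_cst {F : tvsType R} ds (a : F) :
  smooth_along ds (fun=> a).
Proof.
elim: ds a => [|d ds IH] a /=; split => //; try exact: cst_continuous.
split => //; exists (fun=> 0); split=> // p _; exact: has_deriv_cst.
Qed.

Lemma smooth_alongD {F : tvsType R} ds (u v : P -> F) :
  smooth_along ds u -> smooth_along ds v ->
  smooth_along ds (fun p => u p + v p).
Proof.
have contD (a b : P -> F) : {within D, continuous a} ->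
    {within D, continuous b} -> {within D, continuous (fun p => a p + b p)}.
  by move=> ac bc p; apply: tvs_cvgD; [exact: ac|exact: bc].
elim: ds u v => [|d ds IH] u v /= [uc us] [vc vs]; split; try exact: contD.
  by [].
have [us' [u' [du su']]] := us; have [vs' [v' [dv sv']]] := vs.
split; first exact: IH.
exists (fun p => u' p + v' p); split; last exact: IH.
by move=> p Dp; apply: has_derivD; [exact: du|exact: dv].
Qed.

Lemma smooth_along_sum {F : tvsType R} ds n (u : 'I_n -> P -> F) :
  (forall m, smooth_along ds (u m)) ->
  smooth_along ds (fun p => \sum_(m < n) u m p).
Proof.
elim: n u => [|n IH] u us.
  by under eq_fun do rewrite big_ord0; exact: smooth_along_cst.
under eq_fun do rewrite big_ord_recl.
by apply: smooth_alongD => //; apply: IH.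
Qed.

Context {F Y : tvsType R} (hY : hausdorff_space Y).
Context (N : order_of_diff) (W : set F) (g : F -> Y) (G : F -> seq F -> Y).
Hypotheses (lcW : locally_convex_subset W) (diW : has_dense_interior W).
Hypothesis (J : jet N W g G).
Hypothesis (D0D : D0 `<=` D).
Hypothesis (line_in : forall d p, D0 p ->
  \forall t \near (0 : R^o)^', D (line d p t)).

Lemma jet_comp_continuous (f : P -> F) (us : seq (P -> F)) :
  le_order (size us) N -> (forall p, D p -> W (f p)) ->
  {within D, continuous f} ->
  (forall m, (m < size us)%N -> {within D, continuous (nth (fun=> 0) us m)}) ->
  {within D, continuous (fun p => G (f p) [seq u p | u <- us])}.
Proof.
move=> sN fW /subspace_continuousP fc usc; have [_ Jc _] := J.
apply/subspace_continuousP => p Dp.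
apply: (Jc _ _ f (fun q => [seq u q | u <- us])) => //.
- exact: fW.
- by apply: filterS (withinT _ _) => q; exact: fW.
- exact: fc.
- by rewrite size_map.
- split=> [q|m]; first by rewrite !size_map.
  have [lem|gem] := ltnP m (size us); last first.
    under eq_fun do rewrite nth_default ?size_map//.
    by rewrite nth_default ?size_map//; exact: cvg_cst.
  under eq_fun do rewrite (nth_map (fun=> 0))//.
  rewrite (nth_map (fun=> 0))//.
  by have /subspace_continuousP := usc m lem; exact.
Qed.

(** Each differentiation either adds one argument to [G] or differentiates one
    of the arguments, so [size us + size ds] never increases; this is where the
    order [r + s] of [g] comes from. *)
Lemma smooth_along_comp ds (f : P -> F) (us : seq (P -> F)) :
  le_order (size us + size ds) N -> (forall p, D p -> W (f p)) ->
  smooth_along ds f ->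
  (forall m, (m < size us)%N -> smooth_along ds (nth (fun=> 0) us m)) ->
  smooth_along ds (fun p => G (f p) [seq u p | u <- us]).
Proof.
move=> + fW; elim: ds f us fW => [|d ds IH] f us fW sN fs uss.
- split=> //; apply: jet_comp_continuous => //.
  + by rewrite addn0 in sN.
  + exact: fs.1.
  + by move=> m lem; exact: (uss m lem).1.
- split.
    apply: jet_comp_continuous => //.
    + by apply: le_orderW sN; exact: leq_addr.
    + exact: fs.1.
    + by move=> m lem; exact: (uss m lem).1.
  have {}uss m : (m < size us)%N -> _ := fun h => (uss m h).2.
  have [_ [fs' [f' [df sf']]]] := fs.
  split.
    apply: IH => //; first by apply: le_orderW sN; rewrite leq_add2l.
    by move=> m lem; have [] := uss m lem.
  have /choice[us' us'P] : forall m, exists u' : P -> F, (m < size us)%N ->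
      (forall p, D0 p -> has_deriv (fun t => nth (fun=> 0) us m (line d p t))
         (nth (fun=> 0) us m p) (u' p)) /\ smooth_along ds u'.
    move=> m; have [lem|_] := ltnP m (size us); last by exists (fun=> 0).
    by have [_ [u' ?]] := uss m lem; exists u'.
  exists (fun p => G (f p) [seq u p | u <- rcons us f'] +
    \sum_(m < size us)
      G (f p) [seq u p | u <- take m us ++ us' m :: drop m.+1 us]).
  split.
  + move=> p D0p.
    have := @jet_chain _ _ _ _ _ _ _ hY lcW diW J (fun t => f (line d p t))
      (fun t => [seq u (line d p t) | u <- us]) (f p) (f' p)
      [seq u p | u <- us] (mkseq (us'^~ p) (size us)).
    rewrite size_map map_rcons.
    under [X in _ + X]eq_bigr => m _.
      rewrite nth_mkseq// -map_take -map_drop -(map_cons (fun u => u p)).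
      rewrite -map_cat.
      over.
    apply.
    * by apply: fW; exact: D0D.
    * by apply: filterS (line_in d D0p) => t; exact: fW.
    * exact: df.
    * by apply: le_orderW sN; rewrite addnS ltnS leq_addr.
    * by move=> t; rewrite !size_map.
    * move=> m lem; rewrite (nth_map (fun=> 0))// nth_mkseq//.
      under eq_fun do rewrite (nth_map (fun=> 0))//.
      by have [+ _] := us'P m lem; apply.
  + apply: smooth_alongD.
      apply: IH => //.
        by rewrite size_rcons addSnnS.
      move=> m; rewrite size_rcons ltnS nth_rcons => lem.
      case: ltnP => [h|h]; first by have [] := uss m h.
      by rewrite eqn_leq lem h.
    apply: smooth_along_sum => m.
    have szt : size (take m us) = m by rewrite size_takel// ltnW.
    have sz : size (take m us ++ us' m :: drop m.+1 us) = size us.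
      by rewrite size_cat /= szt size_drop subnSK// subnKC// ltnW.
    apply: IH => //.
    * by rewrite sz; apply: le_orderW sN; rewrite leq_add2l.
    * move=> k; rewrite sz => lek; rewrite nth_cat szt.
      case: ltnP => [km|mk]; first by rewrite nth_take//; have [] := uss k lek.
      have [->|kNm] := eqVneq k m.
        by rewrite subnn /=; have [] := us'P m (ltn_ord m).
      have mk' : (m < k)%N by rewrite ltn_neqAle eq_sym kNm.
      rewrite -(subnSK mk') /= nth_drop subnKC//.
      by have [] := uss k lek.
Qed.

End SmoothAlong.

(** * Iterated directional derivatives and product topologies *)

Lemma map_nth_enum_ord (T : Type) (x0 : T) (s : seq T) k : size s = k ->
  [seq nth x0 s a | a : 'I_k <- enum 'I_k] = s.
Proof.
move=> <-; rewrite -[RHS](mkseq_nth x0) /mkseq -val_enum_ord -map_comp.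
exact: eq_map.
Qed.

Lemma cvg_pairl {T : Type} {U V : topologicalType} (Fi : set_system T)
    {FF : Filter Fi} (f : T -> U) (g : T -> V) (a : U) (b : V) :
  f @ Fi --> a -> g @ Fi --> b -> (f t, g t) @[t --> Fi] --> ((a, b) : U * V).
Proof. by move=> fa gb; exact: (cvg_pair fa gb). Qed.

Lemma within_continuous_cvg {T : Type} {U V : topologicalType}
    (Fi : set_system T) {FF : Filter Fi} (A : set U) (f : U -> V)
    (u : T -> U) (l : U) :
  {within A, continuous f} -> A l -> (\forall t \near Fi, A (u t)) ->
  u @ Fi --> l -> f (u t) @[t --> Fi] --> f l.
Proof.
move=> /subspace_continuousP fc Al Au ul B /(fc l Al) /= fB.
by have /= := ul _ fB; apply: filterS2 Au => t At; apply.
Qed.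

Section PowerSpace.
Context {R : realType} {E : tvsType R} (k : nat).

Lemma power_cvg (T : Type) (Fi : set_system T) (f : T -> power_space E k)
    (l : power_space E k) : Filter Fi ->
  (forall a, f t a @[t --> Fi] --> l a) -> f @ Fi --> l.
Proof.
move=> FF fl; apply/cvg_sup => a; rewrite cvg_image; last first.
  by rewrite eqEsubset; split=> v // _; exists (fun=> v).
move=> A /fl fA; exists ((fun q : power_space E k => q a) @^-1` A) => //.
by rewrite eqEsubset; split=> [x [q ? <-//]|x Ax]; exists (fun=> x).
Qed.

Lemma power_proj_cvg (a : 'I_k) (l : power_space E k) :
  (fun q : power_space E k => q a) @ l --> l a.
Proof. exact: (@proj_continuous 'I_k (fun=> E) a l). Qed.

End PowerSpace.

Section IterDerive.
Context {R : realType} {E F : tvsType R}.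

Lemma dir_deriveP (f : E -> F) x h : dir_derivable f x h ->
  has_deriv (fun t => f (x + t *: h)) (f x) (dir_derive h f x).
Proof. by move=> [l fl]; exact: (xgetI 0 fl). Qed.

Lemma dir_derive_unique (f : E -> F) x h l : hausdorff_space F ->
  has_deriv (fun t => f (x + t *: h)) (f x) l -> dir_derive h f x = l.
Proof.
move=> hF fl; apply: (has_deriv_unique hF _ fl).
by apply: dir_deriveP; exists l.
Qed.

Lemma iter_derive_rcons (ys : seq E) y (f : E -> F) :
  iter_derive (rcons ys y) f = dir_derive y (iter_derive ys f).
Proof. by elim: ys f => //= z ys IH f; rewrite IH. Qed.

Lemma iter_derivable_rcons (O : set E) (ys : seq E) y (f : E -> F) :
  iter_derivable O (rcons ys y) f ->
  forall x, O x -> has_deriv (fun t => iter_derive ys f (x + t *: y))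
    (iter_derive ys f x) (iter_derive (rcons ys y) f x).
Proof.
rewrite iter_derive_rcons; elim: ys f => [|z ys IH] f /= [fy] Of x Ox.
  by apply: dir_deriveP; exact: fy.
exact: IH.
Qed.

End IterDerive.

Section JetOfCr.
Context {R : realType} {F Y : tvsType R}.

(** The length of the list selects the order [k] and with it the extension of
    [d^k g]. On the interior of [W] the extensions are iterated derivatives, so
    each is a derivative of the previous one there. *)
Lemma Cr_jet (N : order_of_diff) (W : set F) (g : F -> Y) :
  Cr N W g -> exists G, jet N W g G.
Proof.
move=> [gint gext].
have /choice[G GP] : forall k, exists L : F -> seq F -> Y, le_order k N ->
  [/\ forall z ys, W° z -> size ys = k -> L z ys = iter_derive ys g z,
      k = 0%N -> forall z ys, W z -> L z ys = g z
    & forall (T : Type) (Fi : set_system T) (c : T -> F) (u : T -> seq F) z ls,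
        Filter Fi -> W z -> (\forall t \near Fi, W (c t)) -> c @ Fi --> z ->
        size ls = k -> seq_cvg Fi u ls -> L (c t) (u t) @[t --> Fi] --> L z ls].
  move=> k; have [kN|nkN] := pselect (le_order k N); last by exists (fun _ _ => 0).
  have [df [dfc dfi df0]] := gext k kN.
  exists (fun z ys => df (z, fun a : 'I_k => ys`_a)) => _; split.
  - move=> z ys Wz sz; rewrite dfi// /dk /=; congr (iter_derive _ g z).
    exact: map_nth_enum_ord.
  - by move=> k0 z ys Wz; exact: df0.
  - move=> T Fi c u z ls FF Wz Wc cz sls [su uls].
    apply: (within_continuous_cvg dfc) => //.
    + by apply: filterS Wc => t; split.
    + by apply: cvg_pairl => //; apply: power_cvg => a; exact: uls.
exists (fun z ys => G (size ys) z ys); split.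
- move=> z Wz; have [|_ G0 _] := GP 0%N; last exact: G0.
  by case: (N).
- move=> T Fi c u z ls FF Wz Wc cz sN uls.
  under eq_fun do rewrite uls.1.
  by have [_ _ Gc] := GP (size ls) sN; exact: Gc.
- move=> z ys y Wz sN.
  have sysN : le_order (size ys) N by exact: le_orderW sN.
  have Gi x : W° x -> G (size ys) x ys = iter_derive ys g x.
    by move=> Wx; have [Gi _ _] := GP _ sysN; exact: Gi.
  have [Gi' _ _] := GP _ sN.
  rewrite Gi// size_rcons Gi'// ?size_rcons//.
  have [gd _] := gint _ sN.
  have gys : iter_derivable W° (rcons ys y) g.
    have := gd (fun a : 'I_(size ys).+1 => (rcons ys y)`_a).
    by rewrite map_nth_enum_ord ?size_rcons.
  have := iter_derivable_rcons gys Wz; apply: has_deriv_near.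
  have : \forall t \near (0 : R^o)^', W° (z + t *: y).
    by apply: near_line; exact: nbhs_interior.
  by apply: filterS => t Wt; rewrite Gi.
Qed.

End JetOfCr.

(** * Maps of two variables and the composition theorem *)

Section ParametricLines.
Context {R : realType} {E F : tvsType R} {Q1 Q2 : topologicalType} {S : eqType}.
Context (dir : S -> Q1 -> Q2 -> E).
Context (O : set E) (D : set (E * Q1 * Q2)).
Hypothesis (oO : open O).

(** Directions of derivatives are themselves variables of [d^(i,j)]: they are
    kept in the parameters [p.1.2] and [p.2], which stay fixed along the
    line, and a symbol [d] selects the direction to move in. *)
Definition param_line (d : S) (p : E * Q1 * Q2) (t : R^o) : E * Q1 * Q2 :=
  (p.1.1 + t *: dir d p.1.2 p.2, p.1.2, p.2).

Definition dirs (ds : seq S) (q1 : Q1) (q2 : Q2) : seq E :=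
  [seq dir d q1 q2 | d <- ds].

Let D0 : set (E * Q1 * Q2) := O `*` setT `*` setT.

Lemma smooth_along_iter_derive (ds : seq S) (u : E * Q1 * Q2 -> F) :
  hausdorff_space F -> smooth_along param_line D D0 ds u ->
  exists v : E * Q1 * Q2 -> F, {within D, continuous v} /\
    forall q1 q2 (phi : E -> F), (forall x, O x -> phi x = u (x, q1, q2)) ->
      iter_derivable O (dirs ds q1 q2) phi /\
      forall x, O x -> iter_derive (dirs ds q1 q2) phi x = v (x, q1, q2).
Proof.
move=> hF; elim: ds u => [|d ds IH] u; first by move=> [uc _]; exists u.
move=> [_ [_ [u' [du /IH[v [vc vP]]]]]]; exists v; split => // q1 q2 phi phiu.
have dphi x : O x -> has_deriv (fun t => phi (x + t *: dir d q1 q2)) (phi x)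
    (u' (x, q1, q2)).
  move=> Ox; rewrite phiu//; have := du (x, q1, q2).
  move=> /(_ (conj (conj Ox I) I)); apply: has_deriv_near.
  have : \forall t \near (0 : R^o)^', O (x + t *: dir d q1 q2).
    by apply: near_line; exact: open_nbhs_nbhs.
  by apply: filterS => t Ot; rewrite phiu.
have dphiE x : O x -> dir_derive (dir d q1 q2) phi x = u' (x, q1, q2).
  by move=> Ox; apply: dir_derive_unique => //; exact: dphi.
have [iphi iphiE] := vP q1 q2 _ dphiE.
split=> //=; split => // x Ox; exists (u' (x, q1, q2)); exact: dphi.
Qed.

Definition extends_derivative (f : E -> F) (ds : seq S) : Prop :=
  (forall q1 q2, iter_derivable O (dirs ds q1 q2) f) /\
  exists u : E * Q1 * Q2 -> F, {within D, continuous u} /\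
    forall x q1 q2, O x -> u (x, q1, q2) = iter_derive (dirs ds q1 q2) f x.

(** A function that extends a derivative of [f] along [pre] inherits its own
    derivatives from the extensions along [pre] followed by sublists. *)
Lemma smooth_along_subseq (f : E -> F) (pre ds : seq S) (u : E * Q1 * Q2 -> F) :
  (forall ds', subseq ds' ds -> extends_derivative f (pre ++ ds')) ->
  {within D, continuous u} ->
  (forall x q1 q2, O x -> u (x, q1, q2) = iter_derive (dirs pre q1 q2) f x) ->
  smooth_along param_line D D0 ds u.
Proof.
elim: ds pre u => [//|d ds IH] pre u ext uc uE; split=> //; split.
  apply: (IH pre) => // ds' sds'; apply: ext.
  exact: subseq_trans sds' (subseq_cons _ _).
have [|der [u' [u'c u'E]]] := ext [:: d]; first by rewrite sub1seq mem_head.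
exists u'; split; last first.
  apply: (IH (rcons pre d)) => //.
    by move=> ds' sds'; rewrite cat_rcons; apply: ext; rewrite /= eqxx.
  by move=> x q1 q2 Ox; rewrite u'E// cats1.
move=> [[x q1] q2] [[/= Ox _] _]; rewrite uE// u'E//.
have := der q1 q2; rewrite /dirs map_cat cats1 => /iter_derivable_rcons/(_ x Ox).
apply: has_deriv_near.
have : \forall t \near (0 : R^o)^', O (x + t *: dir d q1 q2).
  by apply: near_line; exact: open_nbhs_nbhs.
by apply: filterS => t Ot; rewrite /param_line /= uE.
Qed.

End ParametricLines.

Lemma le_order0 r : le_order 0 r.
Proof. by case: r. Qed.

Lemma open_prod {A B : topologicalType} (X : set A) (Z : set B) :
  open X -> open Z -> open (X `*` Z).
Proof.
move=> oX oZ; rewrite openE => -[a b] [/= Xa Zb].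
by exists (X, Z) => //; split; apply: open_nbhs_nbhs.
Qed.

Section Projections.
Context {A B C : topologicalType} (D : set (A * B * C)) (p : A * B * C).

Lemma cvg_within_fst_fst :
  (fun q : A * B * C => q.1.1) @ within D (nbhs p) --> p.1.1.
Proof.
apply: cvg_within_filter; apply: (@cvg_comp _ _ _ fst fst _ (nbhs p.1)).
  exact: cvg_fst.
exact: cvg_fst.
Qed.

Lemma cvg_within_snd_fst :
  (fun q : A * B * C => q.1.2) @ within D (nbhs p) --> p.1.2.
Proof.
apply: cvg_within_filter; apply: (@cvg_comp _ _ _ fst snd _ (nbhs p.1)).
  exact: cvg_fst.
exact: cvg_snd.
Qed.

Lemma cvg_within_snd :
  (fun q : A * B * C => q.2) @ within D (nbhs p) --> p.2.
Proof. by apply: cvg_within_filter; exact: cvg_snd. Qed.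

End Projections.

Section CrsDirections.
Context {R : realType} {E1 E2 F : tvsType R} (i j : nat).

(** Symbols for the directions make it possible to speak of a sublist of the
    directions uniformly in [w] and [v]. *)
Definition dij_direction (d : 'I_j + 'I_i) (w : power_space E1 i)
    (v : power_space E2 j) : E1 * E2 :=
  match d with inl b => (0, v b) | inr a => (w a, 0) end.

Definition dij_symbols (bs : seq 'I_j) (as_ : seq 'I_i) : seq ('I_j + 'I_i) :=
  map inl bs ++ map inr as_.

Lemma dirs_dij_symbols w v :
  dirs dij_direction (dij_symbols (enum 'I_j) (enum 'I_i)) w v =
    dij_directions w v.
Proof. by rewrite /dirs map_cat; congr (_ ++ _); rewrite -map_comp. Qed.

Lemma dirs_dij_symbols_sub bs as_ w v :
  dirs dij_direction (dij_symbols bs as_) w v =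
    dij_directions (fun a => w (tnth (in_tuple as_) a))
      (fun b => v (tnth (in_tuple bs) b)).
Proof.
have tE (T : Type) (S : eqType) (h : S -> T) (xs : seq S) :
    [seq h x | x <- xs] = [seq h (tnth (in_tuple xs) a) | a <- enum 'I_(size xs)].
  transitivity [seq h x | x <- [seq tnth (in_tuple xs) a | a <- enum 'I_(size xs)]].
    by rewrite map_tnth_enum.
  by rewrite -map_comp.
by rewrite /dirs map_cat; congr (_ ++ _); rewrite -map_comp tE.
Qed.

(** A sublist of [dij_symbols] keeps the derivatives in the second variable
    innermost, so the derivative of [f] along it is again one of the
    [d^(i',j') f], with [i' <= i] and [j' <= j]. *)
Lemma subseq_dij_symbols ds :
  subseq ds (dij_symbols (enum 'I_j) (enum 'I_i)) ->
  exists bs as_, [/\ ds = dij_symbols bs as_, (size bs <= j)%N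
    & (size as_ <= i)%N].
Proof.
move=> /subseqP[m]; rewrite size_cat (size_map inl) (size_map inr) !size_enum_ord => sm ->.
exists (mask (take j m) (enum 'I_j)), (mask (drop j m) (enum 'I_i)).
rewrite -{1}(cat_take_drop j m) mask_cat; last first.
  by rewrite (size_map inl) size_enum_ord size_takel// sm leq_addr.
rewrite /dij_symbols !map_mask; split=> //.
  by rewrite -[leqRHS](size_enum_ord j) size_subseq ?mask_subseq.
by rewrite -[leqRHS](size_enum_ord i) size_subseq ?mask_subseq.
Qed.

Lemma reindex_cvg (A : tvsType R) n k (h : 'I_k -> 'I_n) (q : power_space A n)
    (T : Type) (Fi : set_system T) (u : T -> power_space A n) :
  Filter Fi -> u @ Fi --> q ->
  (fun t => (fun a => u t (h a)) : power_space A k) @ Fi -->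
    ((fun a => q (h a)) : power_space A k).
Proof.
move=> FF uq; apply: power_cvg => a.
by move=> B qB; exact: (uq _ (@power_proj_cvg _ _ _ (h a) q B qB)).
Qed.

(** The derivative along a sublist of the directions is [d^(i',j') f] with its
    directions picked from the parameters, and picking coordinates is
    continuous. *)
Lemma Crs_smooth_along (r s : order_of_diff) (U : set E1) (V : set E2)
    (f : E1 * E2 -> F) : le_order i r -> le_order j s -> Crs r s U V f ->
  smooth_along (param_line dij_direction) (U `*` V `*` setT `*` setT)
    (U° `*` V° `*` setT `*` setT) (dij_symbols (enum 'I_j) (enum 'I_i))
    (fun p => f p.1.1).
Proof.
move=> ir js [fint fext].
apply: (@smooth_along_subseq _ _ _ _ _ _ dij_direction (U° `*` V°) _ _ f [::]).
- by apply: open_prod; exact: open_interior.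
- move=> _ /= /subseq_dij_symbols[bs [as_ [-> sbs sas]]].
  have {}ir := le_orderW sas ir; have {}js := le_orderW sbs js.
  split=> [w v|].
    by rewrite dirs_dij_symbols_sub; have [+ _] := fint _ _ ir js; apply.
  have [df [dfc dfi _]] := fext _ _ ir js.
  exists (fun p => df (p.1.1, fun a => p.1.2 (tnth (in_tuple as_) a),
    fun b => p.2 (tnth (in_tuple bs) b))); split; last first.
    by move=> [x y] w v [/= Ux Vy]; rewrite dfi// dirs_dij_symbols_sub.
  apply/subspace_continuousP => -[[[x y] w] v] [[[/= Ux Vy] _] _].
  apply: (within_continuous_cvg dfc) => //.
  + by apply: filterS (withinT _ _) => p [[UV _] _].
  + apply: cvg_pairl; first apply: cvg_pairl.
    * exact: cvg_within_fst_fst.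
    * apply: (@reindex_cvg E1 _ _ _ w _ _ (fun q => q.1.2)).
      exact: cvg_within_snd_fst.
    * apply: (@reindex_cvg E2 _ _ _ v _ _ (fun q => q.2)).
      exact: cvg_within_snd.
- have [df [dfc _ /(_ erefl erefl) df0]] := fext 0%N 0%N (le_order0 r) (le_order0 s).
  apply/subspace_continuousP => -[[[x y] w] v] [[[/= Ux Vy] _] _].
  set D := _ `*` _.
  have lim : df (p.1.1, fun=> 0, fun=> 0) @[p --> within D (nbhs (x, y, w, v))] -->
      df ((x, y), fun=> 0, fun=> 0).
    apply: (within_continuous_cvg dfc) => //.
      by apply: filterS (withinT _ _) => p [[UV _] _].
    apply: cvg_pairl; last exact: cvg_cst.
    by apply: cvg_pairl; [exact: cvg_within_fst_fst|exact: cvg_cst].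
  rewrite df0// in lim; apply: cvg_near_eq lim.
  apply: filterS (withinT _ _) => -[[[x' y'] w'] v'] [[[Ux' Vy'] _] _].
  exact: df0.
- by [].
Qed.

End CrsDirections.

Lemma add_order_le (i j : nat) (r s : order_of_diff) :
  le_order i r -> le_order j s -> le_order (i + j) (add_order r s).
Proof. by case: r s => [m|] [n|] //=; exact: leq_add. Qed.

Theorem lemma3p18 (R : realType) (E1 E2 F Y : tvsType R)
    (hausE1 : hausdorff_space E1) (hausE2 : hausdorff_space E2)
    (hausF : hausdorff_space F) (hausY : hausdorff_space Y)
    (U : set E1) (V : set E2) (W : set F)
    (lcU : locally_convex_subset U) (diU : has_dense_interior U)
    (lcV : locally_convex_subset V) (diV : has_dense_interior V)
    (lcW : locally_convex_subset W) (diW : has_dense_interior W)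
    (r s : order_of_diff) (f : E1 * E2 -> F) (g : F -> Y)
    (f_Crs : Crs r s U V f)
    (f_UV_W : f @` (U `*` V) `<=` W)
    (g_Cr : Cr (add_order r s) W g) :
  Crs r s U V (g \o f).
Proof.
have [G J] := Cr_jet g_Cr.
have fW x y : U x -> V y -> W (f (x, y)).
  by move=> Ux Vy; apply: f_UV_W; exists (x, y).
pose h (i j : nat) (p : E1 * E2 * power_space E1 i * power_space E2 j) :=
  G (f p.1.1) [::].
have gh i j (p : E1 * E2 * power_space E1 i * power_space E2 j) :
    (U `*` V `*` setT `*` setT) p -> h i j p = g (f p.1.1).
  move: p => [[[x y] w] v] [[[/= Ux Vy] _] _].
  by have [Gg _ _] := J; apply: Gg; exact: fW.
have hsmooth i j : le_order i r -> le_order j s ->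
    smooth_along (param_line (@dij_direction R E1 E2 i j))
      (U `*` V `*` setT `*` setT) (U° `*` V° `*` setT `*` setT)
      (dij_symbols (enum 'I_j) (enum 'I_i)) (h i j).
  move=> ir js.
  apply: (smooth_along_comp hausY lcW diW J _ _ (us := [::])) => //.
  - by move=> [[[x y] w] v] [[[/= Ux Vy] _] _]; do 3?split => //=;
      exact: interior_subset.
  - move=> d [[[x y] w] v] [[[/= Ux Vy] _] _].
    have : \forall t \near (0 : R^o)^',
        (U° `*` V°) ((x, y) + t *: dij_direction d w v).
      apply: near_line; apply: open_nbhs_nbhs; split=> //.
      by apply: open_prod; exact: open_interior.
    by apply: filterS => t [Ut Vt]; do 3?split => //=; exact: interior_subset.
  - rewrite /= add0n size_cat (size_map inl) (size_map inr) !size_enum_ord addnC.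
    exact: add_order_le.
  - by move=> [[[x y] w] v] [[[/= Ux Vy] _] _]; exact: fW.
  - exact: Crs_smooth_along f_Crs.
have main i j : le_order i r -> le_order j s ->
  exists dh : E1 * E2 * power_space E1 i * power_space E2 j -> Y,
    {within U `*` V `*` [set: power_space E1 i]
       `*` [set: power_space E2 j], continuous dh} /\
    forall w v, iter_derivable (U° `*` V°) (dij_directions w v) (g \o f) /\
      forall x, (U° `*` V°) x ->
        iter_derive (dij_directions w v) (g \o f) x = dh (x, w, v).
  move=> ir js.
  have oUV : open (U° `*` V°) by apply: open_prod; exact: open_interior.
  have [dh [dhc dhP]] := smooth_along_iter_derive oUV hausY (hsmooth i j ir js).
  exists dh; split => // w v; rewrite -dirs_dij_symbols; apply: dhP.
  move=> [x y] [/= Ux Vy]; rewrite gh//.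
  by do 3?split => //=; exact: interior_subset.
split=> i j ir js; have [dh [dhc dhP]] := main i j ir js.
- split=> [w v|]; first by have [] := dhP w v.
  apply: (@subspace_eq_continuous _ _ _ dh).
    move=> [[x w] v]; rewrite inE => -[[xUV _] _].
    exact: esym ((dhP w v).2 x xUV).
  apply: continuous_subspaceW dhc => -[[[x y] w] v] [[[/= Ux Vy] _] _].
  by do 3?split => //=; exact: interior_subset.
(* the values of [dh] outside the interior are not specified, whereas for order
   [(0, 0)] the extension must be [g \o f] on all of [U x V]; there [h] is
   taken *)
- have [[i0 j0]|nij] := pselect (i = 0%N /\ j = 0%N).
    exists (h i j); split.
    + exact: smooth_along_continuous (hsmooth i j ir js).
    + move=> x y w v Ux Vy; rewrite gh; last first.
        by do 3?split => //=; exact: interior_subset.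
      by move: w v; rewrite i0 j0 => w v; rewrite /dij /dij_directions !enum_ord0.
    + by move=> _ _ x y w v Ux Vy; rewrite gh.
  exists dh; split=> //.
  + by move=> x y w v Ux Vy; exact: esym ((dhP w v).2 (x, y) (conj Ux Vy)).
  + by move=> i0 j0; case: nij.
Qed.
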